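(* Let $P$ be any prior distribution over $\mathcal F$, let $c>0$, $h\in(0,1)$ and $\delta\in(0,1)$, and set $C=\frac{2h^4c}{1+16h^2c}$. Then with probability at least $1-\delta$ over $S=(z_1,\dots,z_m)\sim\mathcal D^m$, simultaneously for all distributions $Q$ over $\mathcal F$, $$\mathcal L_{\mathcal D}(Q)\;\le\;\hat{\mathcal L}_S(Q)+\frac{c}{m}\sum_{i=1}^m\mathbb E_{f\sim Q}\big[f(z_i)-(1+h)\,\ell_Q(z_i)\big]^2+\frac{4}{Cm}\Big[3\,\mathrm{KL}(Q\|P)+\log\frac1\delta+5\Big].$$
   Context: Let $(\mathcal Z,\Sigma)$ be a measurable space and $\mathcal D$ a probability distribution on $\mathcal Z$. Let $\mathcal F$ be a class of measurable functions $f:\mathcal Z\to\{0,1\}$ (a zero–one loss class), equipped with a $\sigma$-algebra for which $(f,z)\mapsto f(z)$ is jointly measurable; ''distributions over $\mathcal F$'' are probability measures on this $\sigma$-algebra. A sample $S=(z_1,\dots,z_m)\sim\mathcal D^m$ consists of i.i.d. draws from $\mathcal D$. For $f\in\mathcal F$: $\mathcal L_{\mathcal D}(f)=\mathbb E_{z\sim\mathcal D}f(z)$ and $\hat{\mathcal L}_S(f)=\frac1m\sum_{i=1}^m f(z_i)$. For a distribution $Q$ over $\mathcal F$ and $z\in\mathcal Z$, write $\ell_Q(z)=\mathbb E_{f\sim Q}f(z)$; the Gibbs risk is $\mathcal L_{\mathcal D}(Q)=\mathbb E_{f\sim Q}\mathcal L_{\mathcal D}(f)$ and the Gibbs empirical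 risk is $\hat{\mathcal L}_S(Q)=\frac1m\sum_{i=1}^m\ell_Q(z_i)$. $\mathrm{KL}(Q\|P)$ denotes the relative entropy, equal to $+\infty$ unless $Q\ll P$. The prior $P$ is fixed independently of $S$. The quantity $\frac1m\sum_{i=1}^m\mathbb E_{f\sim Q}[f(z_i)-(1+h)\ell_Q(z_i)]^2$ is called the $h$-flatness of $Q$ with respect to $S$. *)

(* Defs.v *)
From HB Require Import structures.
From mathcomp Require Import all_boot all_order all_algebra.
From mathcomp Require Import all_classical all_reals all_analysis.
Import Order.TTheory GRing.Theory Num.Theory.
Set Implicit Arguments. Unset Strict Implicit. Unset Printing Implicit Defensive.
Local Open Scope classical_set_scope.
Local Open Scope ring_scope.

Section pac_bayes_defs.
Variables (R : realType).

(* A zero-one loss class: F is a measurable space of "functions", ev f z is the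
   value f(z) in {0,1}, and (f,z) |-> f(z) is jointly measurable. *)
Definition zero_one_loss_class (dF dZ : measure_display)
  (F : measurableType dF) (Z : measurableType dZ) (ev : F -> Z -> R) : Prop :=
  (forall f z, ev f z = 0 \/ ev f z = 1) /\
  measurable_fun [set: F * Z] (fun p : F * Z => ev p.1 p.2).

(* Dm is the m-fold product D^m on samples S = (z_1,...,z_m) (m-tuples):
   it is the (unique) probability on m.-tuple Z whose value on every measurable
   rectangle A_1 x ... x A_m is prod_i D(A_i). *)
Definition iid_product (dZ : measure_display) (Z : measurableType dZ)
  (D : probability Z R) (m : nat) (Dm : probability (m.-tuple Z) R) : Prop :=
  forall A : 'I_m -> set Z, (forall i, measurable (A i)) ->
    Dm [set S : m.-tuple Z | forall i, A i (tnth S i)] = (\prod_(i < m) D (A i))%E.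

Local Open Scope ereal_scope.

Definition risk (dF dZ : measure_display) (F : measurableType dF)
  (Z : measurableType dZ) (ev : F -> Z -> R) (D : probability Z R) (f : F) : \bar R :=
  \int[D]_z (ev f z)%:E.

Definition ellQ (dF dZ : measure_display) (F : measurableType dF)
  (Z : measurableType dZ) (ev : F -> Z -> R) (Q : probability F R) (z : Z) : R :=
  fine (\int[Q]_f (ev f z)%:E).

Definition gibbs_risk (dF dZ : measure_display) (F : measurableType dF)
  (Z : measurableType dZ) (ev : F -> Z -> R) (D : probability Z R)
  (Q : probability F R) : \bar R :=
  \int[Q]_f risk ev D f.

Definition gibbs_emp_risk (dF dZ : measure_display) (F : measurableType dF)
  (Z : measurableType dZ) (ev : F -> Z -> R) (m : nat) (S : m.-tuple Z)
  (Q : probability F R) : \bar R :=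
  ((m%:R)^-1 * \sum_(i < m) ellQ ev Q (tnth S i))%:E.

Definition flatness (dF dZ : measure_display) (F : measurableType dF)
  (Z : measurableType dZ) (ev : F -> Z -> R) (h : R) (m : nat) (S : m.-tuple Z)
  (Q : probability F R) : \bar R :=
  (m%:R)^-1%:E *
    \sum_(i < m) \int[Q]_f ((ev f (tnth S i) - (1 + h) * ellQ ev Q (tnth S i)) ^+ 2)%:E.

Definition KL (dF : measure_display) (F : measurableType dF)
  (Q P : probability F R) : \bar R :=
  if `[< Q `<< P >] then
    \int[Q]_f (ln (fine (Radon_Nikodym (charge_of_finite_measure Q) P f)))%:E
  else +oo.

End pac_bayes_defs.

(* Main.v *)
(** For a [0/1] loss, [E_Q (f(z) - (1 + h) l_Q(z))^2 = l_Q - (1 - h^2) l_Q^2],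
    which is at least [h^2 l_Q] because [l_Q] lies in [0, 1]. Hence empirical
    risk plus [c] times flatness dominates [(1 + c h^2)] times the empirical
    risk, and Catoni's PAC-Bayes bound at inverse temperature [eps = c h^2]
    suffices. That bound comes from
    [E_S exp (m a p(f) - eps sum_i f(z_i)) <= 1], with [a = eps / (1 + eps)] and
    [p] the risk, integrated against the prior (Tonelli), Markov's inequality,
    and the Donsker-Varadhan inequality. *)
Require Import Defs.
From HB Require Import structures.
From mathcomp Require Import all_boot all_order all_algebra.
From mathcomp Require Import all_classical all_reals all_analysis.
From mathcomp Require Import measurable_realfun ring lra.
Import Order.TTheory GRing.Theory Num.Theory.
Local Open Scope classical_set_scope.
Local Open Scope ring_scope.

Set Implicit Arguments.
Unset Strict Implicit.

(** * Integration tools and positivity of Radon-Nikodym densities *)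

(** The order passes to positive parts and, reversed, to negative parts, where comparison of
    nonnegative integrals applies. Infinite integrals are allowed because the log-density in [KL]
    may integrate to [+oo]. *)
Lemma ae_le_integral d (T : measurableType d) (R : realType)
    (mu : {measure set T -> \bar R}) (f g : T -> \bar R) :
  measurable_fun setT f -> measurable_fun setT g ->
  {ae mu, forall x, (f x <= g x)%E} ->
  (\int[mu]_x f x <= \int[mu]_x g x)%E.
Proof.
move=> mf mg fg; rewrite integralE [leRHS]integralE; apply: leeB.
- apply: ae_ge0_le_integral => //; [exact: measurable_funepos..|].
  apply: filterS fg => x fgx _; rewrite unlock.
  by rewrite ge_max !le_max fgx lexx orbT.
- apply: ae_ge0_le_integral => //; [exact: measurable_funeneg..|].
  apply: filterS fg => x fgx _; rewrite unlock.
  by rewrite ge_max !le_max leeN2 fgx lexx orbT.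
Qed.

Lemma probability_bounded_integrable d (T : measurableType d) (R : realType)
    (P : probability T R) (u : T -> R) (B : R) :
  measurable_fun setT u -> (forall x, `|u x| <= B) ->
  P.-integrable setT (EFin \o u).
Proof.
move=> mu uB; apply: measurable_bounded_integrable => //.
  exact: le_lt_trans (probability_le1 P measurableT) (ltry _).
by exists B; split=> [|M BM x _]; [exact: num_real|exact: le_trans (uB x) (ltW BM)].
Qed.

(* [expR (- ln g)] is [g^-1] where the density [g] is positive and [1] where it
   vanishes; measurability is immediate for the former. *)
Lemma integral_density_inv_le d (T : measurableType d) (R : realType)
    (Q P : probability T R) (v : T -> R) : Q `<< P ->
  measurable_fun setT v -> (forall x, 0 <= v x) ->
  (\int[Q]_x (v x * expR (- ln (fine (Radon_Nikodym_SigmaFinite.f Q P x))))%:E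
   <= \int[P]_x (v x)%:E)%E.
Proof.
move=> QP mv v0; set g := Radon_Nikodym_SigmaFinite.f Q P.
have g0 x : (0 <= g x)%E by exact: Radon_Nikodym_SigmaFinite.f_ge0.
have gfin x : g x \is a fin_num by exact: Radon_Nikodym_SigmaFinite.f_fin_num.
have mg : measurable_fun setT g.
  exact: measurable_int (Radon_Nikodym_SigmaFinite.f_integrable QP).
have mV : measurable_fun setT (fun x => v x * expR (- ln (fine (g x)))).
  apply: measurable_funM => //.
  do 3! apply: measurableT_comp => //.
  exact: measurableT_comp.
rewrite -(Radon_Nikodym_SigmaFinite.change_of_variables QP)//; last 2 first.
- by move=> x; rewrite lee_fin mulr_ge0// expR_ge0.
- exact/measurable_EFinP.
apply: ge0_le_integral => //.
- by move=> x _; rewrite mule_ge0// lee_fin mulr_ge0// expR_ge0.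
- by apply: emeasurable_funM => //; exact/measurable_EFinP.
- exact/measurable_EFinP.
- move=> x _; rewrite -/g -(fineK (gfin x)) -EFinM lee_fin -mulrA.
  rewrite ler_piMr//; have [->|gx0] := eqVneq (fine (g x)) 0.
    by rewrite mulr0.
  have gx_gt0 : 0 < fine (g x) by rewrite lt_neqAle eq_sym gx0 fine_ge0.
  by rewrite expRN lnK// mulVf.
Qed.

(** [KL] is written with [Radon_Nikodym], whereas the everywhere nonnegative and finite version is
    easier to handle. The two agree outside a [P]-null set, which is [Q]-null by absolute
    continuity. *)
Lemma Radon_Nikodym_ae_gt0 d (T : measurableType d) (R : realType)
    (Q P : probability T R) : Q `<< P ->
  {ae Q, forall x, (0 < Radon_Nikodym_SigmaFinite.f Q P x)%E /\
    Radon_Nikodym (charge_of_finite_measure Q) P x =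
    Radon_Nikodym_SigmaFinite.f Q P x}.
Proof.
move=> QP; set g := Radon_Nikodym_SigmaFinite.f Q P.
have g0 x : (0 <= g x)%E by exact: Radon_Nikodym_SigmaFinite.f_ge0.
have mg : measurable_fun setT g.
  exact: measurable_int (Radon_Nikodym_SigmaFinite.f_integrable QP).
have gpos : {ae Q, forall x, (0 < g x)%E}.
  (* The [Q]-mass of the zero set of the density is the [P]-integral of the density over that set,
     hence zero. *)
  exists (g @^-1` [set 0%E]); split.
  - rewrite -[X in measurable X]setTI; apply: mg => //.
  - rewrite (Radon_Nikodym_SigmaFinite.f_integral QP); last first.
      by rewrite -[X in measurable X]setTI; apply: mg.
    by apply: integral0_eq => x; exact.
  - move=> x /= /negP; rewrite -leNgt => gx0.
    by apply/eqP; rewrite eq_le gx0 g0.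
have eqg : {ae Q, forall x,
    Radon_Nikodym (charge_of_finite_measure Q) P x = g x}.
  have [N [mN PN sN]] := ae_eq_Radon_Nikodym_SigmaFinite QP measurableT.
  exists N; split => //.
    by apply/(measure0_null_setP _ mN)/QP/(measure0_null_setP _ mN).
  apply: subset_trans sN => x /= neq eq; apply: neq.
  exact/esym/eq.
by apply: filterS2 gpos eqg.
Qed.

(** * The Donsker-Varadhan inequality *)

(** With [g] the density of [Q], integrate the tangent inequality [1 + x <= expR x] at
    [x = u - k - ln g] against [Q]. The right side has [Q]-integral at most 1 by change of measure,
    so the two ones cancel. Here [k] is any upper bound on the log-moment of [u] under [P]. *)
Lemma donsker_varadhan d (T : measurableType d) (R : realType)
    (Q P : probability T R) (u : T -> R) (B k : R) : Q `<< P ->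
  measurable_fun setT u -> (forall x, `|u x| <= B) ->
  (\int[P]_x (expR (u x))%:E <= (expR k)%:E)%E ->
  (\int[Q]_x (u x)%:E <= KL Q P + k%:E)%E.
Proof.
move=> QP mu uB Puk; rewrite /KL asboolT//.
set g := Radon_Nikodym_SigmaFinite.f Q P.
set rn := Radon_Nikodym _ _.
pose w x := expR (u x - k).
have mw : measurable_fun setT w.
  by apply: measurableT_comp => //; exact: measurable_funB.
have Pw : (\int[P]_x (w x)%:E <= 1)%E.
  under eq_integral do rewrite /w addrC expRD EFinM.
  rewrite ge0_integralZl_EFin ?expR_ge0//.
  - have -> : 1%E = ((expR (- k))%:E * (expR k)%:E)%E.
      by rewrite -EFinM -expRD addNr expR0.
    by rewrite lee_pmul2l// lte_fin expR_gt0.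
  - by apply/measurable_EFinP; exact: measurableT_comp.
pose V x := w x * expR (- ln (fine (g x))).
have QV : (\int[Q]_x (V x)%:E <= 1)%E.
  apply: le_trans Pw; apply: integral_density_inv_le => // x; exact: expR_ge0.
have V0 x : 0 <= V x.
  by rewrite mulr_ge0 ?expR_ge0.
have mg : measurable_fun setT g.
  exact: measurable_int (Radon_Nikodym_SigmaFinite.f_integrable QP).
have mV : measurable_fun setT V.
  apply: measurable_funM => //.
  do 3! apply: measurableT_comp => //.
  exact: measurableT_comp.
have iV : Q.-integrable setT (EFin \o V).
  apply/integrableP; split; first exact/measurable_EFinP.
  under eq_integral do rewrite /= ger0_norm//.
  by apply: le_lt_trans QV _; rewrite ltry.
have iu : Q.-integrable setT (EFin \o (fun x => u x + (1 - k))).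
  apply: (@probability_bounded_integrable _ _ _ _ _ (B + `|1 - k|)).
    exact: measurable_funD.
  by move=> x; rewrite (le_trans (ler_normD _ _))// lerD2r.
have iu0 : Q.-integrable setT (EFin \o u).
  exact: probability_bounded_integrable uB.
(* The tangent inequality, rearranged with [V = expR (u - k - ln g)]. It holds only almost
   everywhere because [rn] is identified with [g] only there. *)
have ae1 : {ae Q, forall x,
    ((u x + (1 - k))%:E - (V x)%:E <= (ln (fine (rn x)))%:E)%E}.
  apply: filterS (Radon_Nikodym_ae_gt0 QP) => x [gx0 rnE].
  rewrite /rn rnE -EFinB lee_fin -/g.
  have fg0 : 0 < fine (g x).
    by rewrite fine_gt0// gx0 ltey_eq Radon_Nikodym_SigmaFinite.f_fin_num.
  have -> : V x = expR (u x - k - ln (fine (g x))).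
    by rewrite expRD.
  have := expR_ge1Dx (u x - k - ln (fine (g x))); lra.
have le1 : (\int[Q]_x ((u x + (1 - k))%:E - (V x)%:E) <=
   \int[Q]_x (ln (fine (rn x)))%:E)%E.
  apply: ae_le_integral.
  - apply: emeasurable_funB; last exact/measurable_EFinP.
    by apply/measurable_EFinP; exact: measurable_funD.
  - apply/measurable_EFinP; apply: measurableT_comp => //.
    apply: (measurableT_comp (@fine_measurable R setT measurableT)).
    by apply: measurable_int; exact: Radon_Nikodym_integrable.
  - exact: ae1.
(* The 1 in [1 - k] pays for the integral of [V], which is at most 1. *)
have : (\int[Q]_x ((u x + (1 - k))%:E - (V x)%:E) >=
    \int[Q]_x (u x)%:E - k%:E)%E.
  rewrite integralB//.
  under [in leRHS]eq_integral do rewrite EFinD.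
  rewrite integralD//; last exact: finite_measure_integrable_cst.
  rewrite integral_cst// [X in (_ * X)%E](probability_setT Q) mule1.
  have Qfin := integrable_fin_num measurableT iu0.
  have Vfin := integrable_fin_num measurableT iV.
  rewrite -(fineK Qfin) -(fineK Vfin) -!EFinB lee_fin.
  have : fine (\int[Q]_x (V x)%:E) <= 1 by rewrite -lee_fin fineK.
  rewrite /=; lra.
by move=> /le_trans/(_ le1); rewrite leeBlDr.
Qed.

(** Donsker-Varadhan at [u = 0] and [k = 0]. *)
Lemma KL_ge0 d (T : measurableType d) (R : realType) (Q P : probability T R) :
  (0 <= KL Q P)%E.
Proof.
have [QP|QP] := pselect (Q `<< P); last by rewrite /KL asboolF.
have := @donsker_varadhan _ _ _ Q P (cst 0) 0 0 QP.
rewrite integral0 adde0; apply => // [x|]; first by rewrite normr0.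
under eq_integral do rewrite expR0.
by rewrite integral_cst// [X in (_ * X)%E](probability_setT P) mule1 expR0.
Qed.

(** * Exponential moments of an i.i.d. sample *)

(** [iid_product] speaks only of rectangles. Expanding a product of simple functions over all
    choices [phi] of one index per coordinate gives a combination of indicators of rectangles, which
    can be integrated directly. Simple functions suffice since the loss takes two values. *)
Lemma iid_integral_prod_sum d (Z : measurableType d) (R : realType)
    (D : probability Z R) (m : nat) (Dm : probability (m.-tuple Z) R)
    (J : finType) (w : J -> R) (A : J -> set Z) :
  iid_product D Dm -> (forall j, 0 <= w j) -> (forall j, measurable (A j)) ->
  (\int[Dm]_S (\prod_(i < m) \sum_j w j * \1_(A j) (tnth S i))%:E =
   ((\sum_j w j * fine (D (A j))) ^+ m)%:E)%E.
Proof.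
move=> iidDm w0 mA.
pose box (phi : {ffun 'I_m -> J}) : set (m.-tuple Z) :=
  [set S | forall i, A (phi i) (tnth S i)].
have mbox phi : measurable (box phi).
  rewrite (_ : box phi = \bigcap_(i in [set: 'I_m])
      ((fun S : m.-tuple Z => tnth S i) @^-1` A (phi i))); last first.
    by apply/seteqP; split=> S /= H i; [move=> _; exact: H|exact: H].
  apply: fin_bigcap_measurable => // i _.
  by rewrite -[X in measurable X]setTI; apply: measurable_tnth.
have prodE S : \prod_(i < m) (\sum_j w j * \1_(A j) (tnth S i)) =
    \sum_(phi : {ffun 'I_m -> J}) (\prod_i w (phi i)) * \1_(box phi) S.
  rewrite bigA_distr_bigA; apply: eq_bigr => phi _.
  rewrite big_split /=; congr (_ * _).
  have [Sbox|Sbox] := pselect (box phi S).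
    rewrite big1 => [|i _]; first by rewrite indicE mem_set.
    by rewrite indicE mem_set//; exact: Sbox.
  rewrite indicE memNset//.
  move/existsNP : Sbox => [i nAi].
  by rewrite (bigD1 i)//= indicE memNset// mul0r.
under eq_integral do rewrite prodE -sumEFin.
rewrite ge0_integral_sum//; last 2 first.
- move=> phi; apply/measurable_EFinP; apply: measurable_funM => //.
- move=> phi S _; rewrite lee_fin mulr_ge0// prodr_ge0// => i _.
(* The power is expanded over the same choices [phi], so both sides match term by term. *)
rewrite -[in RHS](card_ord m) -prodr_const bigA_distr_bigA -sumEFin.
apply: eq_bigr => phi _.
under eq_integral do rewrite EFinM.
rewrite ge0_integralZl_EFin//; last 2 first.
- exact/measurable_EFinP.
- by rewrite prodr_ge0.
have boxE : Dm (box phi) = (\prod_(i < m) D (A (phi i)))%E.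
  by apply: (iidDm (fun i => A (phi i))) => i.
rewrite integral_indic// setIT [X in (_ * X)%E]boxE.
rewrite big_split/= EFinM; congr (_ * _)%E.
rewrite -prodEFin; apply: eq_bigr => i _.
by rewrite fineK// fin_num_measure.
Qed.

(** On values 0 and 1, [expR (- eps * g)] is at most [1 - a * g], because
    [expR (- eps) <= (1 + eps)^-1 = 1 - a]. Each coordinate thus contributes at most
    [1 - a * p <= expR (- a * p)], which the factor [expR (m * a * p)] compensates. *)
Lemma iid_bernoulli_mgf_le d (Z : measurableType d) (R : realType)
    (D : probability Z R) (m : nat) (Dm : probability (m.-tuple Z) R)
    (g : Z -> R) (eps : R) :
  iid_product D Dm -> 0 <= eps ->
  measurable_fun setT g -> (forall z, g z = 0 \/ g z = 1) ->
  (\int[Dm]_S (expR (m%:R * (eps / (1 + eps)) * fine (\int[D]_z (g z)%:E) -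
     eps * \sum_(i < m) g (tnth S i)))%:E <= 1)%E.
Proof.
move=> iidDm eps0 mg g01; set p := fine _; set a := eps / (1 + eps).
have eps1 : 0 < 1 + eps by rewrite ltr_pwDl.
have a1 : 1 - a = (1 + eps)^-1 by rewrite /a; field; rewrite gt_eqF.
pose A := g @^-1` [set 1].
have mA : measurable A by rewrite -[A]setTI; exact: mg.
have gE z : g z = \1_A z.
  rewrite indicE; have [gz|gz] := g01 z.
    by rewrite memNset// /A /= gz => /eqP; rewrite eq_sym oner_eq0.
  by rewrite mem_set.
have DA : D A = p%:E.
  rewrite /p; under eq_integral do rewrite gE.
  by rewrite integral_indic// setIT fineK// fin_num_measure.
(* The majorant [1 - a * g] as a simple function: value [1 - a] on [A] and 1 on its complement. *)
pose w (b : bool) := if b then 1 - a else 1.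
pose B (b : bool) := if b then A else ~` A.
have w0 b : 0 <= w b by case: b => //=; rewrite a1 invr_ge0 ltW.
have mB b : measurable (B b) by case: b => //=; exact: measurableC.
have mS : measurable_fun setT (fun S : m.-tuple Z => \sum_(i < m) g (tnth S i)).
  apply: measurable_sum => i.
  by apply: measurableT_comp => //; exact: measurable_tnth.
pose K := expR (m%:R * a * p).
have le S : expR (m%:R * a * p - eps * \sum_(i < m) g (tnth S i)) <=
    K * \prod_(i < m) \sum_b w b * \1_(B b) (tnth S i).
  rewrite expRD ler_pM2l ?expR_gt0// mulr_sumr -sumrN.
  rewrite expR_sum; apply: ler_prod => i _; rewrite expR_ge0/=.
  rewrite big_bool /= indicC gE /w /B.
  rewrite !indicE; case: (_ \in A) => /=; last first.
    by rewrite !mulr0 oppr0 expR0 add0r mulr1.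
  rewrite !mulr1 mulr0 addr0 a1 expRN lef_pV2 ?posrE ?expR_gt0//.
  exact: expR_ge1Dx.
apply: (@le_trans _ _ (\int[Dm]_S
    (K%:E * (\prod_(i < m) \sum_b w b * \1_(B b) (tnth S i))%:E))%E).
  apply: ge0_le_integral => //.
  - apply/measurable_EFinP; apply: measurableT_comp => //.
    by apply: measurable_funB => //; exact: measurable_funM.
  - apply/measurable_EFinP; apply: measurable_funM => //.
    apply: measurable_prod => i _; apply: measurable_sum => b.
    apply: measurable_funM => //.
    apply: measurableT_comp; first exact: measurable_indic.
    exact: measurable_tnth.
  - by move=> S _; rewrite -EFinM lee_fin.
rewrite ge0_integralZl_EFin//; last 3 first.
- move=> S _; rewrite lee_fin prodr_ge0// => i _.
  by apply: sumr_ge0 => b _; rewrite mulr_ge0.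
- apply/measurable_EFinP; apply: measurable_prod => i _.
  apply: measurable_sum => b; apply: measurable_funM => //.
  apply: measurableT_comp; first exact: measurable_indic.
  exact: measurable_tnth.
- exact: expR_ge0.
rewrite (iid_integral_prod_sum iidDm)// -EFinM lee_fin.
rewrite big_bool /= probability_setC// DA -EFinB /=.
have -> : (1 - a) * p + 1 * (1 - p) = 1 - a * p by ring.
have -> : K = expR (a * p) ^+ m by rewrite -expRM_natl mulrA.
(* It remains to see that the base [expR (a * p) * (1 - a * p)] lies between 0 and 1. *)
rewrite -exprMn exprn_ile1//.
  rewrite mulr_ge0 ?expR_ge0// subr_ge0.
  have p0 : 0 <= p by rewrite -lee_fin -DA.
  have p1 : p <= 1 by rewrite -lee_fin -DA probability_le1.
  have a_le1 : a <= 1 by rewrite -subr_ge0 a1 invr_ge0 ltW.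
  nra.
rewrite -[leRHS](expR0 R) -(subrr (a * p)) expRD ler_pM2l ?expR_gt0//.
exact: expR_ge1Dx.
Qed.

(** Markov's inequality at level [delta^-1], phrased to supply the good event as a measurable
    set. *)
Lemma markov_event d (T : measurableType d) (R : realType)
    (P : probability T R) (G : T -> \bar R) (delta : R) : 0 < delta ->
  measurable_fun setT G -> (forall x, 0 <= G x)%E ->
  (\int[P]_x G x <= 1)%E ->
  exists A : set T, [/\ measurable A, (P A >= (1 - delta)%:E)%E &
    forall x, A x -> (G x <= (delta^-1)%:E)%E].
Proof.
move=> delta0 mG G0 G1.
pose B := [set x | ((delta^-1)%:E <= G x)%E].
have mB : measurable B.
  by have := emeasurable_fun_c_infty measurableT mG (delta^-1)%:E; rewrite setTI.
exists (~` B); split; first exact: measurableC.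
- rewrite probability_setC// EFinB leeB//.
  have := @le_integral_abse _ _ _ P _ measurableT G delta^-1 mG.
  rewrite invr_gt0 => /(_ delta0); rewrite setTI.
  under eq_set do rewrite gee0_abs//.
  under eq_integral do rewrite gee0_abs//.
  move=> /le_trans/(_ G1); rewrite lee_pdivrMl// mule1; exact.
- by move=> x /negP; rewrite -ltNge => /ltW.
Qed.

(** * Zero-one losses and Catoni's PAC-Bayes bound *)

Section loss_class.
Context (R : realType) dZ (Z : measurableType dZ) dF (F : measurableType dF).
Variables (ev : F -> Z -> R).
Hypothesis hev : zero_one_loss_class ev.

Lemma loss_ge0 f z : 0 <= ev f z.
Proof. by have [->|->] := hev.1 f z. Qed.

Lemma loss_le1 f z : ev f z <= 1.
Proof. by have [->|->] := hev.1 f z. Qed.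

Lemma measurable_loss_l z : measurable_fun setT (ev ^~ z).
Proof. exact: (measurableT_comp hev.2 (pair2_measurable z)). Qed.

Lemma measurable_loss_r f : measurable_fun setT (ev f).
Proof. exact: (measurableT_comp hev.2 (pair1_measurable f)). Qed.

Lemma integrable_loss (Q : probability F R) z :
  Q.-integrable setT (EFin \o ev ^~ z).
Proof.
apply: (@probability_bounded_integrable _ _ _ _ _ 1).
  exact: measurable_loss_l.
by move=> f; rewrite ger0_norm ?loss_ge0 ?loss_le1.
Qed.

(** The integral is finite, so the [fine] in [ellQ] never falls back on its default value. *)
Lemma integral_loss (Q : probability F R) z :
  (\int[Q]_f (ev f z)%:E = (ellQ ev Q z)%:E)%E.
Proof.
rewrite /ellQ fineK//.
exact: (integrable_fin_num measurableT (integrable_loss Q z)).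
Qed.

Lemma ellQ_ge0 (Q : probability F R) z : 0 <= ellQ ev Q z.
Proof.
by rewrite fine_ge0// integral_ge0// => f _; rewrite lee_fin loss_ge0.
Qed.

Lemma ellQ_le1 (Q : probability F R) z : ellQ ev Q z <= 1.
Proof.
rewrite -lee_fin -integral_loss -(probability_setT Q) -[leRHS]mul1e.
rewrite -integral_cst//; apply: ge0_le_integral => //.
- by move=> f _; rewrite lee_fin loss_ge0.
- by apply/measurable_EFinP; exact: measurable_loss_l.
- by move=> f _; rewrite lee_fin loss_le1.
Qed.

Variable D : probability Z R.

Lemma risk_ge0 f : (0 <= risk ev D f)%E.
Proof. by rewrite integral_ge0// => z _; rewrite lee_fin loss_ge0. Qed.

Lemma risk_le1 f : (risk ev D f <= 1)%E.
Proof.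
rewrite -(probability_setT D) -[leRHS]mul1e.
rewrite -integral_cst//; apply: ge0_le_integral => //.
- by move=> z _; rewrite lee_fin loss_ge0.
- by apply/measurable_EFinP; exact: measurable_loss_r.
- by move=> z _; rewrite lee_fin loss_le1.
Qed.

Lemma risk_fin_num f : risk ev D f \is a fin_num.
Proof.
by rewrite ge0_fin_numE ?risk_ge0// (le_lt_trans (risk_le1 f)) ?ltry.
Qed.

Lemma measurable_risk : measurable_fun setT (risk ev D).
Proof.
apply: (@measurable_fun_fubini_tonelli_F _ _ _ _ _ D
  (fun p => (ev p.1 p.2)%:E)).
- by apply/measurable_EFinP; case: hev.
- by move=> p; rewrite lee_fin loss_ge0.
Qed.

(** Uniformity in [Q] comes from choosing the event through the prior alone: it bounds the
    [P]-average [G S] of [expR (u S f)]. Donsker-Varadhan then handles every [Q] on that one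
    event. *)
Lemma pac_bayes_catoni (m : nat) (Dm : probability (m.-tuple Z) R)
    (P : probability F R) (eps delta : R) :
  iid_product D Dm -> 0 <= eps -> 0 < delta ->
  exists A : set (m.-tuple Z), [/\ measurable A, (Dm A >= (1 - delta)%:E)%E &
    forall S, A S -> forall Q : probability F R,
      ((m%:R * (eps / (1 + eps)))%:E * gibbs_risk ev D Q -
         (eps * \sum_(i < m) ellQ ev Q (tnth S i))%:E <=
       KL Q P + (ln delta^-1)%:E)%E].
Proof.
move=> iidDm eps0 delta0; set c := m%:R * _.
have c0 : 0 <= c by rewrite mulr_ge0// divr_ge0// addr_ge0.
pose r f := fine (risk ev D f).
have r0 f : 0 <= r f by rewrite fine_ge0 ?risk_ge0.
have r1 f : r f <= 1 by rewrite -lee_fin fineK ?risk_fin_num ?risk_le1.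
have mr : measurable_fun setT r.
  by apply: measurableT_comp => //; exact: measurable_risk.
pose u S f := c * r f - eps * \sum_(i < m) ev f (tnth S i).
have mu : measurable_fun setT (fun x : m.-tuple Z * F => u x.1 x.2).
  apply: measurable_funB; apply: measurable_funM => //.
    exact: measurableT_comp.
  apply: measurable_sum => i.
  apply: (measurableT_comp hev.2
    (g := fun x : m.-tuple Z * F => (x.2, tnth x.1 i))).
  apply: measurable_fun_pair; first exact: measurable_snd.
  exact: (measurableT_comp (measurable_tnth i) measurable_fst).
have mexpu : measurable_fun setT
    (fun x : m.-tuple Z * F => (expR (u x.1 x.2))%:E).
  by apply/measurable_EFinP; exact: measurableT_comp.
have expu0 (x : m.-tuple Z * F) : (0 <= (expR (u x.1 x.2))%:E)%E.
  by rewrite lee_fin expR_ge0.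
pose G S := (\int[P]_f (expR (u S f))%:E)%E.
have [||||A [mA DmA AG]] := @markov_event _ _ _ Dm G delta.
- exact: delta0.
- exact: (measurable_fun_fubini_tonelli_F (m2 := P) _ mexpu expu0).
- by move=> S; apply: integral_ge0 => f _; exact: (expu0 (S, f)).
(* Since [P] does not depend on the sample, the integrals can be swapped and the moment bound used
   for each fixed [f]. *)
- rewrite /G (fubini_tonelli (m1 := Dm) (m2 := P) _ mexpu expu0).
  apply: (@le_trans _ _ (\int[P]_f 1)%E); last first.
    by rewrite integral_cst// mul1e probability_le1.
  apply: ge0_le_integral => //.
  + by move=> f _; apply: integral_ge0 => S _; exact: (expu0 (S, f)).
  + exact: (measurable_fun_fubini_tonelli_G (m1 := Dm) _ mexpu expu0).
  + move=> f _.
    exact: (iid_bernoulli_mgf_le iidDm eps0 (measurable_loss_r f) (hev.1 f)).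
exists A; split => // S AS Q.
have [QP|QP] := pselect (Q `<< P); last by rewrite /KL asboolF// addye// leey.
have suml0 f : 0 <= \sum_(i < m) ev f (tnth S i).
  by apply: sumr_ge0 => i _; exact: loss_ge0.
have sumlm f : \sum_(i < m) ev f (tnth S i) <= m%:R.
  rewrite -[in leRHS](card_ord m) -sumr_const.
  by apply: ler_sum => i _; exact: loss_le1.
have muS : measurable_fun setT (u S).
  exact: (measurableT_comp mu (pair1_measurable S)).
have uB f : `|u S f| <= c + eps * m%:R.
  have := r0 f; have := r1 f; have := suml0 f; have := sumlm f.
  by rewrite ler_norml /u => *; apply/andP; split; nra.
(* This [k] makes [expR k] equal to the Markov threshold [delta^-1]. *)
have := donsker_varadhan QP muS uB (k := ln delta^-1).
rewrite lnK ?posrE ?invr_gt0// => /(_ (AG _ AS)); apply: le_trans.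
have ir : Q.-integrable setT (EFin \o r).
  apply: (@probability_bounded_integrable _ _ _ _ _ 1) => // f.
  by rewrite ger0_norm.
have isum : Q.-integrable setT (fun f => (\sum_(i < m) (ev f (tnth S i))%:E)%E).
  by apply: integrable_sum => // i _; exact: integrable_loss.
have -> : (\int[Q]_f (u S f)%:E =
    \int[Q]_f (c%:E * (r f)%:E - eps%:E * \sum_(i < m) (ev f (tnth S i))%:E))%E.
  by apply: eq_integral => f _; rewrite sumEFin.
rewrite integralB//; [|exact: integrableZl..].
rewrite !integralZl// integral_sum//; last by move=> i; exact: integrable_loss.
under [in leRHS]eq_bigr do rewrite integral_loss.
rewrite sumEFin -EFinM /gibbs_risk.
by under [in leRHS]eq_integral do rewrite fineK ?risk_fin_num//.
Qed.

End loss_class.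

(** * Flatness against empirical risk *)

(** A zero-one loss equals its own square, so the integrand is affine in [ev f z]; then
    [(1 + h)^2 - 2 * (1 + h) = h^2 - 1]. *)
Lemma integral_sqr_shift_loss (R : realType) dZ (Z : measurableType dZ)
    dF (F : measurableType dF) (ev : F -> Z -> R) (Q : probability F R)
    (h : R) (z : Z) : zero_one_loss_class ev ->
  (\int[Q]_f ((ev f z - (1 + h) * ellQ ev Q z) ^+ 2)%:E =
   (ellQ ev Q z - (1 - h ^+ 2) * ellQ ev Q z ^+ 2)%:E)%E.
Proof.
move=> hev; set l := ellQ ev Q z.
transitivity (\int[Q]_f ((1 - 2 * (1 + h) * l)%:E * (ev f z)%:E +
    (((1 + h) * l) ^+ 2)%:E))%E.
  apply: eq_integral => f _; rewrite -EFinM -EFinD; congr EFin.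
  by have [->|->] := hev.1 f z; ring.
have il := integrable_loss hev Q z.
rewrite integralD//; [|exact: integrableZl|exact: finite_measure_integrable_cst].
rewrite integralZl// integral_loss// integral_cst//.
rewrite [X in (_ + _ * X)%E](probability_setT Q) mule1 -EFinM -EFinD -/l.
congr EFin; ring.
Qed.

(* [h^2 l <= l - (1 - h^2) l^2] on [0, 1]: this absorbs the factor [1 + c h^2]
   that Catoni's bound puts on the empirical risk. *)
Lemma flatness_ge (R : realType) dZ (Z : measurableType dZ)
    dF (F : measurableType dF) (ev : F -> Z -> R) (Q : probability F R)
    (h : R) (m : nat) (S : m.-tuple Z) : zero_one_loss_class ev ->
  h ^+ 2 <= 1 ->
  ((h ^+ 2)%:E * gibbs_emp_risk ev S Q <= flatness ev h S Q)%E.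
Proof.
move=> hev h1; rewrite /flatness /gibbs_emp_risk.
under [in leRHS]eq_bigr do rewrite integral_sqr_shift_loss//.
rewrite sumEFin -!EFinM lee_fin mulrCA ler_wpM2l ?invr_ge0//.
rewrite mulr_sumr; apply: ler_sum => i _.
have := ellQ_ge0 hev Q (tnth S i); have := ellQ_le1 hev Q (tnth S i).
set l := ellQ _ _ _ => l1 l0; rewrite -subr_ge0.
have -> : l - (1 - h ^+ 2) * l ^+ 2 - h ^+ 2 * l = (1 - h ^+ 2) * (l * (1 - l)).
  by ring.
by rewrite !mulr_ge0 ?subr_ge0.
Qed.

(** Together with [gibbs_risk_fin_num], this reduces the final inequality to real arithmetic when
    [KL] is finite. *)
Lemma flatness_fin_num (R : realType) dZ (Z : measurableType dZ)
    dF (F : measurableType dF) (ev : F -> Z -> R) (Q : probability F R)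
    (h : R) (m : nat) (S : m.-tuple Z) : zero_one_loss_class ev ->
  flatness ev h S Q \is a fin_num.
Proof.
move=> hev; rewrite /flatness.
by under eq_bigr do rewrite integral_sqr_shift_loss//; rewrite sumEFin -EFinM.
Qed.

Lemma gibbs_risk_fin_num (R : realType) dZ (Z : measurableType dZ)
    dF (F : measurableType dF) (ev : F -> Z -> R) (Q : probability F R)
    (D : probability Z R) : zero_one_loss_class ev ->
  gibbs_risk ev D Q \is a fin_num.
Proof.
move=> hev; have r0 f : (0 <= risk ev D f)%E by exact: risk_ge0.
rewrite ge0_fin_numE; last by apply: integral_ge0.
apply: (@le_lt_trans _ _ (\int[Q]_f 1)%E); last first.
  rewrite integral_cst// mul1e.
  exact: le_lt_trans (probability_le1 Q measurableT) (ltry _).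
apply: ge0_le_integral => //; first exact: measurable_risk.
by move=> f _; exact: risk_le1.
Qed.

Unset Implicit Arguments.
Set Strict Implicit.

(** * The flatness bound *)

Theorem mainTheorem2 (R : realType)
  (dZ : measure_display) (Z : measurableType dZ)
  (dF : measure_display) (F : measurableType dF)
  (ev : F -> Z -> R) (hev : zero_one_loss_class ev)
  (D : probability Z R)
  (m : nat) (hm : (0 < m)%N)
  (Dm : probability (m.-tuple Z) R) (hDm : iid_product D Dm)
  (P : probability F R)
  (c h delta : R) (hc : 0 < c) (hh : 0 < h < 1) (hdelta : 0 < delta < 1) :
  let C := 2 * h ^+ 4 * c / (1 + 16 * h ^+ 2 * c) in
  exists A : set (m.-tuple Z), measurable A /\
    (Dm A >= (1 - delta)%:E)%E /\
    forall S : m.-tuple Z, A S ->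
      forall Q : probability F R,
        (gibbs_risk ev D Q <=
           gibbs_emp_risk ev S Q + c%:E * flatness ev h S Q
           + (4 / (C * m%:R))%:E *
               (3%:E * KL Q P + (ln (delta^-1))%:E + 5%:E))%E.
Proof.
move=> C; have /andP[h0 h1] := hh; have /andP[delta0 delta1] := hdelta.
have h2_le1 : h ^+ 2 <= 1 by rewrite expr_le1// ltW.
have h2_gt0 : 0 < h ^+ 2 by rewrite exprn_gt0.
pose eps := c * h ^+ 2; have eps0 : 0 < eps by rewrite mulr_gt0.
have m0 : 0 < m%:R :> R by rewrite ltr0n.
have l0 : 0 <= ln delta^-1.
  by rewrite ln_ge0// invf_ge1// ltW.
have [A [mA DmA AQ]] := pac_bayes_catoni hev P hDm (ltW eps0) delta0.
exists A; do 2 split => //; move=> S AS Q.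
have C0 : 0 < C by rewrite divr_gt0// ?addr_gt0 ?mulr_gt0// exprn_gt0.
have coef0 : 0 < 4 / (C * m%:R) by rewrite divr_gt0// mulr_gt0.
have fl := flatness_ge Q S hev h2_le1.
have := AQ S AS Q; have := KL_ge0 Q P.
move: fl; rewrite /gibbs_emp_risk.
rewrite -(fineK (gibbs_risk_fin_num Q D hev)).
rewrite -(fineK (flatness_fin_num Q h S hev)).
set L := fine (gibbs_risk _ _ _); set Fl := fine (flatness _ _ _ _); set s := \sum_(i < m) _.
(* Nonnegativity rules out [-oo]; at [+oo] the positive coefficient makes the right side
   infinite. *)
case: (KL Q P) => [k| |//]; last first.
  move=> _ _ _; rewrite gt0_muley ?lte_fin// !addye//.
  by rewrite gt0_muley ?lte_fin// addey// leey.
rewrite -!(EFinM, EFinB, EFinD) !lee_fin => fl k0 cat.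
(* In terms of [eps], [C = 2 * h^2 * eps / (1 + 16 * eps)], so the claim reads
   [(1 + eps) * h^2 <= 2 * (1 + 16 * eps)], which follows from [h^2 <= 1]. *)
have coef : (1 + eps) / (eps * m%:R) <= 4 / (C * m%:R).
  have -> : 4 / (C * m%:R) = 2 * (1 + 16 * eps) / h ^+ 2 / (eps * m%:R).
    rewrite /C /eps; field.
    by rewrite !gt_eqF// ?addr_gt0 ?mulr_gt0// mulr_gt0.
  rewrite ler_pM2r ?invr_gt0 ?mulr_gt0// ler_pdivlMr//.
  have : 0 <= 1 + eps by rewrite addr_ge0// ltW.
  by move=> /ler_piMr/(_ h2_le1)/le_trans; apply; lra.
(* Catoni's bound divided by [m * eps / (1 + eps)]. *)
have L_le : L <= (1 + eps) * (m%:R^-1 * s) +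
    (1 + eps) / (eps * m%:R) * (k + ln delta^-1).
  have -> : L = (1 + eps) / (eps * m%:R) * (m%:R * (eps / (1 + eps)) * L).
    by field; rewrite !gt_eqF// addr_gt0.
  have -> : (1 + eps) * (m%:R^-1 * s) = (1 + eps) / (eps * m%:R) * (eps * s).
    by field; rewrite !gt_eqF.
  rewrite -mulrDr ler_pM2l ?divr_gt0 ?addr_gt0 ?mulr_gt0//; lra.
(* The excess [eps] times the empirical risk is absorbed by [c * Fl]. In the complexity term the
   coefficient grows by [coef], and the bracket grows from [k + ln delta^-1] to the stated one
   because [k >= 0]. *)
apply: (le_trans L_le); apply: lerD.
  have := ler_wpM2l (ltW hc) fl; rewrite /eps; lra.
apply: ler_pM => //; [|exact: addr_ge0|lra].
by rewrite divr_ge0 ?addr_ge0 ?mulr_ge0// ltW.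
Qed.
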